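(* Suppose the plus connected occupied component $C^+(0)$ containing the origin is finite. Then the outermost boundary $\partial^+_0$ of $C^+(0)$ is a unique cycle in the graph $G_0^+$ with the following properties: (i) All squares of $C^+(0)$ are contained in the interior of $\partial^+_0$. (ii) Every edge in $\partial^+_0$ is a boundary edge adjacent to an occupied square of $C^+(0)$ contained in the interior of $\partial_0^+$ and a vacant square in the exterior of $\partial_0^+$.
   Context: Tiling: $\mathbb{R}^2$ is tiled into unit squares $\{S_k\}_{k\ge 0}$ with disjoint interiors, the axis-parallel unit squares centred at the points of $\mathbb{Z}^2$, with the origin the centre of $S_0$. Every square is either occupied or vacant, and $S_0$ is always occupied. For $i \ne j$, $S_i$ and $S_j$ are plus adjacent if they share an edge. Component: $S_i$ is connected to $S_j$ by an occupied plus connected $S$-path if there is a sequence of distinct occupied squares $(Y_1,\dots,Y_t)$ from $\{S_k\}$ with $Y_1=S_i$, $Y_t=S_j$ and $Y_l$ plus adjacent to $Y_{l+1}$ for $1\le l\le t-1$. $C^+(0)$ is the collection of all occupied squares connected to $S_0$ by an occupied plus connected $S$-path (it contains $S_0$). Graph: $G_0^+$ is the graph whose vertices are the corners of the squares of $C^+(0)$ and whose edges are the (unit length) edges of the squares of $C^+(0)$. An edge is adjacent to a square if it is one of the four edges of that square. A cycle is a simple (non-self-intersecting) cycle of the graph, i.e. every vertex of the cycle is an endvertex of exactly two of its edges. Interior/exterior: a cycle $C$ divides the plane into a bounded connected region, its interior, and an unbounded connected region, its exterior. A square lies in the interior (resp. exterior) of $C$ if its open square is contained in the interior (resp. exterior)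 of $C$. An edge $e$ is contained in the interior (resp. exterior) of $C$ if both squares of $\{S_k\}$ having $e$ as an edge lie in the interior (resp. exterior) of $C$. Boundary edges: an edge $e$ is a boundary edge if it is adjacent to a vacant square and also adjacent to an occupied square of $C^+(0)$. An edge $e$ of $G_0^+$ is an outermost boundary edge of $C^+(0)$ if for every cycle $C$ in $G_0^+$, either $e$ is an edge of $C$ or $e$ belongs to the exterior of $C$. The outermost boundary $\partial_0^+$ of $C^+(0)$ is the set of all outermost boundary edges of $G_0^+$. *)

(* Defs.v *)
From mathcomp Require Import all_boot all_order all_algebra.
From mathcomp Require Import all_classical all_reals all_analysis.
Import Order.TTheory GRing.Theory Num.Theory numFieldNormedType.Exports.

Set Implicit Arguments.
Unset Strict Implicit.
Unset Printing Implicit Defensive.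

Local Open Scope classical_set_scope.
Local Open Scope ring_scope.

(* [z : square] is the unit square centred at the lattice point z. *)
Definition square : Type := (int * int)%type.

(* [c : corner] is the point c - (1/2, 1/2), the lower left corner of the
   square centred at c. *)
Definition corner : Type := (int * int)%type.

(* [(c, true)] is the horizontal unit edge with left endvertex c, and
   [(c, false)] the vertical unit edge with lower endvertex c. *)
Definition edge : Type := (corner * bool)%type.

Definition edge_src (e : edge) : corner := e.1.

Definition edge_tgt (e : edge) : corner :=
  if e.2 then (e.1.1 + 1, e.1.2) else (e.1.1, e.1.2 + 1).

Definition joins (e : edge) (u v : corner) : Prop :=
  (edge_src e = u /\ edge_tgt e = v) \/ (edge_src e = v /\ edge_tgt e = u).

(* Bottom, top, left and right edges. *)
Definition square_edges (z : square) : seq edge :=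
  [:: (z, true); ((z.1, z.2 + 1), true); (z, false); ((z.1 + 1, z.2), false)].

Definition adjacent_to (e : edge) (z : square) : Prop := e \in square_edges z.

Definition plus_adj : rel square :=
  [rel z w | (z != w) && has (mem (square_edges w)) (square_edges z)].

(* [occ] is the set of occupied squares; its complement is the set of vacant
   squares. *)
Definition occ_connected (occ : set square) (z w : square) : Prop :=
  exists p : seq square,
    [/\ uniq (z :: p), {in z :: p, forall y, occ y},
        path plus_adj z p & last z p = w].

Definition origin_component (occ : set square) : set square :=
  [set z | occ_connected occ z (0, 0)].

Definition graph_edges (occ : set square) : set edge :=
  [set e | exists2 z, origin_component occ z & adjacent_to e z].

(* A cycle is identified with its set of edges; [vs] lists its vertices, without
   repetition, in cyclic order. *)
Definition is_cycle (occ : set square) (C : set edge) : Prop :=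
  exists vs : seq corner,
    [/\ (2 < size vs)%N, uniq vs,
        {in vs, forall v, exists2 e, graph_edges occ e & joins e v (next vs v)}
      & C = [set e | exists2 v, v \in vs & joins e v (next vs v)]].

Section Plane.
Variable R : realType.

Definition corner_pt (c : corner) : R * R :=
  (c.1%:~R - 2^-1, c.2%:~R - 2^-1).

Definition open_square (z : square) : set (R * R) :=
  [set p | `|p.1 - z.1%:~R| < 2^-1 /\ `|p.2 - z.2%:~R| < 2^-1].

(* The source of an edge lies to the left of or below its target, so the box
   spanned by the two endvertices is the closed segment between them. *)
Definition segment (e : edge) : set (R * R) :=
  let a := corner_pt (edge_src e) in
  let b := corner_pt (edge_tgt e) in
  [set p | a.1 <= p.1 <= b.1 /\ a.2 <= p.2 <= b.2].

Definition curve (C : set edge) : set (R * R) := \bigcup_(e in C) segment e.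

(* By the Jordan curve theorem the complement of a cycle has one bounded and one
   unbounded connected component. *)
Definition cycle_interior (C : set edge) : set (R * R) :=
  [set p | (~` curve C) p /\ bounded_set (connected_component (~` curve C) p)].

Definition cycle_exterior (C : set edge) : set (R * R) :=
  [set p | (~` curve C) p /\ ~ bounded_set (connected_component (~` curve C) p)].

Definition square_in_interior (C : set edge) (z : square) : Prop :=
  open_square z `<=` cycle_interior C.

Definition square_in_exterior (C : set edge) (z : square) : Prop :=
  open_square z `<=` cycle_exterior C.

Definition edge_in_exterior (C : set edge) (e : edge) : Prop :=
  forall z, adjacent_to e z -> square_in_exterior C z.

Definition outermost_boundary (occ : set square) : set edge :=
  [set e | graph_edges occ e /\
     forall C, is_cycle occ C -> C e \/ edge_in_exterior C e].

End Plane.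

Definition boundary_edge (occ : set square) (e : edge) : Prop :=
  (exists2 z, ~ occ z & adjacent_to e z) /\
  (exists2 z, origin_component occ z & adjacent_to e z).

Definition encloses (R : realType) (occ : set square) (C : set edge) : Prop :=
  forall z, origin_component occ z -> square_in_interior R C z.

Definition inside_occ_outside_vac (R : realType) (occ : set square) (C : set edge) : Prop :=
  forall e, C e ->
    [/\ boundary_edge occ e,
        exists z, [/\ origin_component occ z, adjacent_to e z & square_in_interior R C z]
      & exists z, [/\ ~ occ z, adjacent_to e z & square_in_exterior R C z]].

(* Main.v *)
Require Import Defs.
From mathcomp Require Import all_boot all_order all_algebra.
From mathcomp Require Import all_classical all_reals all_analysis.
From mathcomp Require Import zify lra.
Import Order.TTheory GRing.Theory Num.Theory numFieldNormedType.Exports.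
Local Open Scope classical_set_scope.
Local Open Scope ring_scope.

(* Let [U] be the set of squares from which one can escape to the top of the
   plane through squares outside the component [A] of the origin, and let [D] be
   the set of edges separating a square of [U] from a square outside [U]; the
   latter is then in [A]. No corner has exactly one edge of [D], so [D] contains
   a simple cycle [Z]. The parity of the number of edges of [Z] met by the
   horizontal ray to the right of a square changes exactly across the edges of
   [Z]; it vanishes on [U] and is constant on the connected set [A], hence it
   changes across every edge of [D], and [Z = D]. Topologically, squares sharing
   an edge not in a cycle lie in the same component of its complement, so that
   [U] is exterior to every cycle of the graph; conversely the union of the
   closed squares outside [U] is bounded and, off [D], open and closed, so [A]
   is interior to [D]. Finally, a cycle enclosing [A] must contain [D], and
   a simple cycle contains no other one. *)

Set Implicit Arguments.
Unset Strict Implicit.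

(** * Lattice edges and simple cycles *)

(** With three or more vertices a cyclic walk never turns straight back, so it traverses each of its
    edges only once. *)
Lemma next_next_neq (T : eqType) (vs : seq T) (v : T) :
  uniq vs -> (2 < size vs)%N -> v \in vs -> next vs (next vs v) != v.
Proof.
move=> Uvs szvs /rot_to[n [|x [|y p]] Evs].
- by move: szvs; rewrite -(size_rot n) Evs.
- by move: szvs; rewrite -(size_rot n) Evs.
have := Uvs; rewrite -(rot_uniq n) -!(next_rot n Uvs) Evs /= !inE !negb_or.
case/andP=> /and3P[vx vy _] _; rewrite eqxx /= (eq_sym x) (negPf vx) eqxx.
by rewrite eq_sym.
Qed.

(** Induction around the cycle: rotated to start at [v], the list is the path of iterates of [next]
    from [v]. *)
Lemma next_closed (T : eqType) (vs : seq T) (P : T -> Prop) (v : T) :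
  uniq vs -> v \in vs -> P v ->
  (forall w, w \in vs -> P w -> P (next vs w)) ->
  forall w, w \in vs -> P w.
Proof.
move=> Uvs vvs Pv Pnext w wvs.
have [n p Evs] := rot_to vvs.
have: path (frel (next vs)) v p.
  have := cycle_next Uvs; rewrite -(rot_cycle n) Evs /= rcons_path.
  by case/andP.
have: {subset v :: p <= vs} by move=> x; rewrite -Evs mem_rot.
have: w \in v :: p by rewrite -Evs mem_rot.
elim: p v Pv {vvs Evs} => [|y p IHp] v Pv; first by rewrite inE => /eqP->.
rewrite inE.
case/predU1P=> [->//|wp] sub /= /andP[/eqP Ey pth].
apply: (IHp y) => //; first by rewrite -Ey; apply/Pnext/Pv/sub/mem_head.
by move=> x xp; apply: sub; rewrite inE xp orbT.
Qed.

Lemma perm_map_next (T : eqType) (vs : seq T) :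
  uniq vs -> perm_eq (map (next vs) vs) vs.
Proof.
move=> Uvs; have Unext : uniq (map (next vs) vs).
  by rewrite map_inj_uniq //; apply: can_inj (prev_next Uvs).
apply: uniq_perm => // x; apply/mapP/idP => [[v vvs ->]|xvs].
  by rewrite mem_next.
by exists (prev vs x); rewrite ?mem_prev ?next_prev.
Qed.

(* A longest path can only be continued back to one of its own vertices. *)
Lemma exists_simple_cycle (T : eqType) (r : rel T) (s : seq T) (a b : T) :
  symmetric r -> irreflexive r -> (forall u v, r u v -> u \in s) ->
  (forall u v, r u v -> exists2 w, w != v & r u w) -> r a b ->
  exists vs, [/\ (2 < size vs)%N, uniq vs & cycle r vs].
Proof.
move=> rC rI rs deg rab.
(* The path grows at its head [x], and [n] is fuel: at [n = 0] the distinct vertices [y :: p], all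
   in [s], would outnumber [s]. *)
suff ext n p x y : (size s < n + size p)%N -> uniq [:: x, y & p] ->
    path r x (y :: p) -> exists vs, [/\ (2 < size vs)%N, uniq vs & cycle r vs].
  apply: (ext (size s).+1 [::] a b); rewrite /= ?rab ?addn0 //= andbT inE.
  by apply: contraTneq rab => ->; rewrite rI.
elim: n p x y => [|n IHn] p x y szp Up pth.
  have sub : {subset y :: p <= s}.
    elim: (y :: p) x pth {szp Up} => //= z q IHq x /andP[rxz pth] w.
    rewrite inE => /predU1P[->|]; last exact: IHq pth w.
    by apply: (rs z x); rewrite rC.
  have Uyp : uniq (y :: p) by case/andP: Up.
  by have := uniq_leq_size Uyp sub; rewrite /=; lia.
have /andP[rxy _] := pth; have [w wy rxw] := deg _ _ rxy.
have [wp|wNp] := boolP (w \in [:: x, y & p]); last first.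
  apply: (IHn (y :: p) w x); rewrite /= ?addnS -?addSn //.
  - by rewrite -/(uniq [:: x, y & p]) wNp.
  - by rewrite rC rxw -/(path r x (y :: p)).
have wx : w != x by apply: contraTneq rxw => ->; rewrite rI.
(* Here [w] lies in [p]: cutting the path there and joining [w] back to [x] closes a cycle through
   the distinct vertices [x], [y] and [w]. *)
move: wp; rewrite !inE (negPf wx) (negPf wy) /= => /splitPr wp.
case: wp Up pth => [p1 p2].
have -> : y :: p1 ++ w :: p2 = (y :: rcons p1 w) ++ p2 by rewrite /= cat_rcons.
rewrite -cat_cons cat_uniq cat_path => /andP[Up _] /andP[pth _].
exists (x :: y :: rcons p1 w); split => //; first by rewrite /= size_rcons.
by rewrite /cycle rcons_path pth last_cons last_rcons rC.
Qed.

(** A corner has the coordinates of the square whose lower left corner it is, so [e.1], read as a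
    square, lies above or to the right of [e]; this is the square across [e]. *)
Definition other_square (e : edge) : square :=
  if e.2 then (e.1.1, e.1.2 - 1) else (e.1.1 - 1, e.1.2).

Lemma adjacent_toP (e : edge) (z : square) :
  adjacent_to e z <-> z = e.1 \/ z = other_square e.
Proof.
case: e z => [[x y] b] [z1 z2].
rewrite /adjacent_to /square_edges /other_square !inE !xpair_eqE /=; split.
  case: b => /= H.
    have : (z1 = x /\ z2 = y) \/ (z1 = x /\ z2 = y - 1) by lia.
    by case=> -[-> ->]; tauto.
  have : (z1 = x /\ z2 = y) \/ (z1 = x - 1 /\ z2 = y) by lia.
  by case=> -[-> ->]; tauto.
by case: b => -[] [-> ->]; lia.
Qed.

Lemma adjacent_to_src (e : edge) : adjacent_to e e.1.
Proof. by apply/adjacent_toP; left. Qed.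

Lemma adjacent_to_other (e : edge) : adjacent_to e (other_square e).
Proof. by apply/adjacent_toP; right. Qed.

Lemma plus_adjP (z w : square) :
  reflect (exists e, [/\ z != w, adjacent_to e z & adjacent_to e w])
          (plus_adj z w).
Proof.
apply: (iffP andP) => [[zw /hasP[e ez ew]]|[e [zw ez ew]]]; first by exists e.
by split=> //; apply/hasP; exists e.
Qed.

Definition on_edge (e : edge) (u v : corner) : bool :=
  (edge_src e == u) && (edge_tgt e == v) ||
  (edge_src e == v) && (edge_tgt e == u).

Lemma on_edgeP (e : edge) (u v : corner) :
  reflect (joins e u v) (on_edge e u v).
Proof.
apply: (iffP orP) => [[]/andP[/eqP ? /eqP ?]|[][-> ->]]; rewrite ?eqxx; by
  [left|right].
Qed.

Lemma joins_sym (e : edge) (u v : corner) : joins e u v -> joins e v u.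
Proof. by case=> ?; [right|left]. Qed.

Lemma joins_neq (e : edge) (u v : corner) : joins e u v -> u != v.
Proof.
by case: e u v => [[x y] []] [? ?] [? ?]; rewrite /joins /edge_src /edge_tgt /=
  xpair_eqE => -[] [[? ?] [? ?]]; lia.
Qed.

Lemma joins_endpoints (e : edge) (u v u' v' : corner) :
  joins e u v -> joins e u' v' -> (u = u' /\ v = v') \/ (u = v' /\ v = u').
Proof. by rewrite /joins => -[] [-> ->] [] [? ?]; tauto. Qed.

Lemma joins_edge (e e' : edge) (u v : corner) :
  joins e u v -> joins e' u v -> e = e'.
Proof.
by case: e e' u v => [[x y] []] [[x' y'] []] [? ?] [? ?];
  rewrite /joins /edge_src /edge_tgt /= => -[] [[? ?] [? ?]] [] [[? ?] [? ?]];
  try (by exfalso; lia); (have -> : x = x' by lia); (have -> : y = y' by lia).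
Qed.

Definition frontier (k : square -> bool) : set edge :=
  [set e | k e.1 != k (other_square e)].

(** In a turn around the corner [u] through its four squares, the value of [k] changes an even
    number of times, so not exactly once. *)
Lemma frontier_degree (k : square -> bool) (e : edge) (u v : corner) :
  frontier k e -> joins e u v ->
  exists2 e', frontier k e' & exists2 w, joins e' u w & w != v.
Proof.
case: u => a b ke euv.
pose star : seq edge :=
  [:: ((a, b), true); ((a, b), false); ((a - 1, b), true); ((a, b - 1), false)].
have estar : e \in star.
  case: e euv {ke} => [[x y] c]; case: v => v1 v2.
  rewrite /joins /edge_src /edge_tgt /= !inE !xpair_eqE /=.
  by case: c => /= -[] [] [? ?] [? ?]; lia.
have star_joins e' : e' \in star -> exists w, joins e' (a, b) w.
  rewrite !inE => /or4P[] /eqP ->; rewrite /joins /edge_src /edge_tgt /=.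
  - by exists (a + 1, b); left.
  - by exists (a, b + 1); left.
  - by exists (a - 1, b); right; rewrite subrK.
  - by exists (a, b - 1); right; rewrite subrK.
suff [e' e'star [ke' e'e]] : exists2 e', e' \in star & frontier k e' /\ e' != e.
  have [w e'w] := star_joins _ e'star; exists e' => //; exists w => //.
  by apply: contra_neq e'e => wv; rewrite wv in e'w; apply: joins_edge e'w euv.
apply: contrapT => none.
have same e' : e' \in star -> e' != e -> k e'.1 = k (other_square e').
  move=> e's e'e; apply: contrapT => /eqP ke'; apply: none; by exists e'.
have in1 : ((a, b), true) \in star by rewrite !inE eqxx.
have in2 : ((a, b), false) \in star by rewrite !inE eqxx ?orbT.
have in3 : ((a - 1, b), true) \in star by rewrite !inE eqxx ?orbT.
have in4 : ((a, b - 1), false) \in star by rewrite !inE eqxx ?orbT.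
have := same _ in1; have := same _ in2; have := same _ in3; have := same _ in4.
move/eqP: ke; rewrite /other_square /= {same none in1 in2 in3 in4 star_joins}.
move: estar; rewrite !inE => /or4P[] /eqP ->; rewrite !xpair_eqE /=.
- by move=> ? /(_ ltac:(lia)) ? /(_ ltac:(lia)) ? /(_ ltac:(lia)) ? _; congruence.
- by move=> ? /(_ ltac:(lia)) ? /(_ ltac:(lia)) ? _ /(_ ltac:(lia)) ?; congruence.
- by move=> ? /(_ ltac:(lia)) ? _ /(_ ltac:(lia)) ? /(_ ltac:(lia)) ?; congruence.
- by move=> ? _ /(_ ltac:(lia)) ? /(_ ltac:(lia)) ? /(_ ltac:(lia)) ?; congruence.
Qed.

(** * Crossing parity *)

Definition cycle_edges (vs : seq corner) : set edge :=
  [set e | exists2 v, v \in vs & joins e v (next vs v)].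

Definition lattice_walk (vs : seq corner) : Prop :=
  {in vs, forall v, exists e, joins e v (next vs v)}.

(* The step from [u] to [v] crosses the horizontal ray going right from the
   centre of [z]. *)
Definition crosses_ray (z : square) (u v : corner) : bool :=
  [&& u.1 == v.1, z.1 < u.1 & (u.2 == z.2) && (v.2 == z.2 + 1) ||
                              (v.2 == z.2) && (u.2 == z.2 + 1)].

Definition parity (vs : seq corner) (z : square) : bool :=
  \big[addb/false]_(v <- vs) crosses_ray z v (next vs v).

(** The ray from the square to the left of the edge is the ray from [c] prolonged across that one
    edge. *)
Lemma crosses_ray_vertical (c u v : corner) :
  (exists e, joins e u v) ->
  crosses_ray c u v (+) crosses_ray (other_square (c, false)) u v =
  on_edge (c, false) u v.
Proof.
case: c u v => c1 c2 [u1 u2] [v1 v2] [[[x y] b]].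
rewrite /joins /edge_src /edge_tgt /crosses_ray /other_square /on_edge.
rewrite /edge_src /edge_tgt !xpair_eqE /=.
by case: b => /= -[] [[? ?] [? ?]]; lia.
Qed.

Definition right_of (c u : corner) : bool := (u.2 == c.2) && (c.1 < u.1).

(** Between the two rays lies the half-line of corners [right_of c]. A vertical step with an
    endpoint there crosses exactly one ray; a horizontal step crosses none, and enters or leaves the
    half-line only along [(c, true)]. Around a closed walk the [right_of] terms cancel. *)
Lemma crosses_ray_horizontal (c u v : corner) :
  (exists e, joins e u v) ->
  crosses_ray c u v (+) crosses_ray (other_square (c, true)) u v =
  on_edge (c, true) u v (+) (right_of c u (+) right_of c v).
Proof.
case: c u v => c1 c2 [u1 u2] [v1 v2] [[[x y] b]].
rewrite /joins /edge_src /edge_tgt /crosses_ray /other_square /on_edge /right_of.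
rewrite /edge_src /edge_tgt !xpair_eqE /=.
have [neq1 neq2] : (y == y + 1) = false /\ (y + 1 == y) = false by lia.
by case: b => /= -[] [[<- <-] [<- <-]]; rewrite ?eqxx ?neq1 ?neq2 /=; lia.
Qed.

Lemma big_addb_next (T : eqType) (vs : seq T) (f : T -> bool) :
  uniq vs ->
  \big[addb/false]_(v <- vs) (f v (+) f (next vs v)) = false.
Proof.
move=> Uvs; rewrite big_split /=.
rewrite -(big_map (next vs) predT f) (perm_big _ (perm_map_next Uvs)) /=.
exact: addbb.
Qed.

(** By the two local identities, only the steps along [e] survive when the difference of the two
    parities is summed over the walk. *)
Lemma parity_jump (vs : seq corner) (e : edge) :
  uniq vs -> (2 < size vs)%N -> lattice_walk vs ->
  parity vs e.1 (+) parity vs (other_square e) = `[< cycle_edges vs e >].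
Proof.
move=> Uvs szvs walk; rewrite /parity -big_split /=.
transitivity (\big[addb/false]_(v <- vs) on_edge e v (next vs v)).
  case: e => c [].
    rewrite -[RHS]addbF -[X in _ = _ (+) X](big_addb_next (right_of c) Uvs).
    rewrite -big_split /=.
    by apply: eq_big_seq => v vvs; apply/crosses_ray_horizontal/walk.
  by apply: eq_big_seq => v vvs; apply/crosses_ray_vertical/walk.
apply/idP/asboolP => [|[v vvs /on_edgeP ev]].
  apply: contraPP => none; rewrite big_seq big1 // => v vvs.
  by apply/on_edgeP => ev; apply: none; exists v.
(* Exactly one step runs along [e]: a second one would be its reverse, from [next vs v] back to [v],
   which [next_next_neq] excludes. *)
rewrite (big_rem v) //= ev big_seq big1 // => w.
rewrite mem_rem_uniq // => /andP[wv wvs]; apply/on_edgeP => ew.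
have [[Ev _]|[Ev Enext]] := joins_endpoints ew (elimT (on_edgeP _ _ _) ev).
  by rewrite Ev eqxx in wv.
by have := next_next_neq Uvs szvs vvs; rewrite -Ev Enext eqxx.
Qed.

Lemma parity_above (vs : seq corner) (z : square) :
  (forall v, v \in vs -> v.2 <= z.2) -> parity vs z = false.
Proof.
move=> below; rewrite /parity big_seq big1 // => v vvs.
have := below v vvs; have := below (next vs v); rewrite mem_next => /(_ vvs).
by rewrite /crosses_ray; case: v (next vs v) z {below vvs} =>
  [v1 v2] [w1 w2] [z1 z2] /=; lia.
Qed.

(** * The squares outside the component *)

Lemma component_origin (occ : set square) :
  occ (0, 0) -> origin_component occ (0, 0).
Proof. by move=> occ0; exists [::]; split=> // y; rewrite inE => /eqP ->. Qed.

Lemma component_step (occ : set square) (e : edge) (z w : square) :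
  origin_component occ z -> occ w -> adjacent_to e z -> adjacent_to e w ->
  origin_component occ w.
Proof.
move=> [p [Up occp pth lastp]] occw ez ew.
have [->|wz] := eqVneq w z; first by exists p.
have wpth : path plus_adj w (z :: p).
  by rewrite /= pth andbT; apply/plus_adjP; exists e.
have lastzp : last w (z :: p) = (0, 0) by [].
(* The path [z :: p] may already pass through [w], so the prolonged path is shortened to one without
   repetition. *)
case: (shortenP wpth) lastzp => q qpth Uq subq lastq.
exists q; split=> // y; rewrite inE => /predU1P[->//|/subq yp].
exact: occp.
Qed.

Lemma component_ind (occ : set square) (P : square -> Prop) :
  P (0, 0) ->
  (forall e z w, origin_component occ z -> origin_component occ w ->
     adjacent_to e z -> adjacent_to e w -> P w -> P z) ->
  forall z, origin_component occ z -> P z.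
Proof.
move=> P0 Pstep z [p].
elim: p z => [|y p IHp] z [Up occp pth lastp]; first by move: lastp => /= ->.
have yP : [/\ uniq (y :: p), {in y :: p, forall x, occ x}, path plus_adj y p
               & last y p = (0, 0)].
  split=> //; first by case/andP: Up.
    by move=> x xp; apply: occp; rewrite inE xp orbT.
  by case/andP: pth.
have /andP[/plus_adjP[e [_ ez ey]] _] := pth.
apply: (Pstep e z y) => //; first by exists (y :: p).
  by exists p.
exact: IHp.
Qed.

(** The base case is the whole half-plane above height [h], which will be an upper bound for [A];
    properties are carried back from there along an escape route by induction. *)
Inductive escapes (A : set square) (h : int) (z : square) : Prop :=
| escapes_top of h < z.2
| escapes_step e w of ~ A z & ~ A w & adjacent_to e z & adjacent_to e w &
    escapes A h w.

Definition boxed (n : int) (A : set square) : Prop :=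
  forall z, A z -> [/\ - n <= z.1, z.1 <= n, - n <= z.2 & z.2 <= n].

Lemma finite_boxed (A : set square) : finite_set A -> exists n, boxed n A.
Proof.
case/finite_seqP=> s ->; elim: s => [|[x y] s [n sn]]; first by exists 0.
exists (Num.max n (Num.max `|x| `|y|)) => -[z1 z2]; rewrite /= inE.
case/predU1P=> [[-> ->]|/sn] /=; first by split; lia.
by case=> /= ? ? ? ?; split; lia.
Qed.

Section Escapes.
Variables (A : set square) (n : int).
Hypothesis An : boxed n A.

Lemma escapes_notin (z : square) : escapes A n z -> ~ A z.
Proof. by case=> [+ /An[]|//]; lia. Qed.

Lemma escapes_adjacent (e : edge) (z w : square) :
  adjacent_to e z -> adjacent_to e w -> escapes A n z -> ~ escapes A n w -> A w.
Proof.
move=> ez ew zesc wNesc; apply: contrapT => wNA; apply: wNesc.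
exact: (escapes_step wNA (escapes_notin zesc) ew ez zesc).
Qed.

(** Beside the box one escapes straight up; below it, first to the right until past the box, then
    up. In the two claims [d] bounds the number of steps left. *)
Lemma outside_box_escapes (z : square) :
  ~~ [&& - n <= z.1, z.1 <= n, - n <= z.2 & z.2 <= n] -> escapes A n z.
Proof.
have out w : ~~ [&& - n <= w.1, w.1 <= n, - n <= w.2 & w.2 <= n] -> ~ A w.
  by move=> /negP wout /An[? ? ? ?]; apply/wout/and4P.
have side (d : nat) (w : square) :
    n < w.2 + d%:Z -> ~~ ((- n <= w.1) && (w.1 <= n)) -> escapes A n w.
  elim: d w => [|d IHd] [x y] /= yd xout; first by apply: escapes_top => /=; lia.
  apply: (@escapes_step _ _ _ ((x, y + 1), true) (x, y + 1)).
  - by apply: out => /=; lia.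
  - by apply: out => /=; lia.
  - by apply/adjacent_toP; right; rewrite /other_square /= addrK.
  - exact: adjacent_to_src.
  - by apply: IHd => //=; lia.
have below (d : nat) (w : square) :
    n < w.1 + d%:Z -> w.2 < - n -> escapes A n w.
  elim: d w => [|d IHd] [x y] /= xd yout.
    by apply: (side (`|n - y|.+1)) => /=; lia.
  apply: (@escapes_step _ _ _ ((x + 1, y), false) (x + 1, y)).
  - by apply: out => /=; lia.
  - by apply: out => /=; lia.
  - by apply/adjacent_toP; right; rewrite /other_square /= addrK.
  - exact: adjacent_to_src.
  - by apply: IHd => //=; lia.
case: z => x y /= xy.
have [yn|yn] := ltP n y; first exact: escapes_top.
have [yn'|yn'] := ltP y (- n); first by apply: (below (`|n - x|.+1)) => /=; lia.
by apply: (side (`|n - y|.+1)) => /=; lia.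
Qed.

Definition outside (z : square) : bool := `[< escapes A n z >].

(** A square outside [A] that shares an edge with an escaping square escapes too, so the
    non-escaping side of a frontier edge is in [A]. *)
Lemma frontier_outsideP (e : edge) :
  frontier outside e <->
  exists z u, [/\ A z, escapes A n u, adjacent_to e z & adjacent_to e u].
Proof.
have e1 := adjacent_to_src e; have e2 := adjacent_to_other e.
split=> [|[z [u [zA uesc ez eu]]]]; last first.
  have zNesc : ~ escapes A n z by move=> /escapes_notin.
  rewrite /frontier /outside /=.
  move: ez eu => /adjacent_toP[] Ez /adjacent_toP[] Eu.
  - by rewrite Ez -Eu in zNesc.
  - by rewrite -Ez -Eu (asboolF zNesc) (asboolT uesc).
  - by rewrite -Ez -Eu (asboolF zNesc) (asboolT uesc).
  - by rewrite Ez -Eu in zNesc.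
rewrite /frontier /outside /=; case: asboolP => esc1; case: asboolP => esc2 // _.
- by exists (other_square e), e.1; split=> //; apply: escapes_adjacent e1 e2 esc1 esc2.
- by exists e.1, (other_square e); split=> //; apply: escapes_adjacent e2 e1 esc2 esc1.
Qed.

(** Along the column going up from [z], the status must change somewhere between [A] and the squares
    above height [n]. *)
Lemma frontier_outside_neq0 (z : square) : A z -> exists e, frontier outside e.
Proof.
move=> zA; apply: contrapT => none.
have column d : escapes A n (z.1, z.2 + d%:Z) -> escapes A n z.
  elim: d => [|d IHd]; first by rewrite addr0 -surjective_pairing.
  move=> esc; apply: IHd; apply: contrapT => Nesc; apply: none.
  exists ((z.1, z.2 + d.+1%:Z), true); rewrite /frontier /outside /other_square /=.
  by rewrite (_ : _ - 1 = z.2 + d%:Z) ?(asboolT esc) ?(asboolF Nesc) //; lia.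
apply: (escapes_notin (column `|n - z.2|.+1 _)) => //.
by apply: escapes_top => /=; lia.
Qed.

End Escapes.

(** * The outer frontier is a simple cycle *)

Lemma joins_corner (e : edge) (u v : corner) (z : square) :
  adjacent_to e z -> joins e u v ->
  u \in [:: z; (z.1 + 1, z.2); (z.1, z.2 + 1); (z.1 + 1, z.2 + 1)].
Proof.
case: e u v z => [[x y] b] [u1 u2] [v1 v2] [z1 z2] /adjacent_toP.
rewrite /other_square /joins /edge_src /edge_tgt !inE !xpair_eqE /=.
by case: b => /= -[] [? ?] [] [[? ?] [? ?]]; lia.
Qed.

(** The edge is constrained only for distinct squares, because the steps of [escapes] and of
    [component_ind] may have [z = w]. *)
Lemma parity_same (vs : seq corner) (e : edge) (z w : square) :
  uniq vs -> (2 < size vs)%N -> lattice_walk vs ->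
  (z != w -> ~ cycle_edges vs e) ->
  adjacent_to e z -> adjacent_to e w -> parity vs z = parity vs w.
Proof.
move=> Uvs szvs walk; have [-> //|_ /(_ isT)/asboolPn/negPf eNvs] := eqVneq z w.
have jump : parity vs e.1 = parity vs (other_square e).
  by have := parity_jump e Uvs szvs walk; rewrite eNvs; do 2!case: (parity _ _).
by move=> /adjacent_toP[]-> /adjacent_toP[]->.
Qed.

Section OuterCycle.
Variables (occ : set square) (n : int).
Hypotheses (occ0 : occ (0, 0)) (An : boxed n (origin_component occ)).
Let A := origin_component occ.
Let D := frontier (outside A n).

Lemma frontier_graph_edges : D `<=` graph_edges occ.
Proof. by move=> e /(frontier_outsideP An)[z [u [? _ ? _]]]; exists z. Qed.

Lemma cycle_edges_frontier (vs : seq corner) :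
  uniq vs -> (2 < size vs)%N ->
  {in vs, forall v, exists2 e, D e & joins e v (next vs v)} ->
  cycle_edges vs = D.
Proof.
move=> Uvs szvs steps.
have walk : lattice_walk vs by move=> v /steps[e _ ?]; exists e.
have sub : cycle_edges vs `<=` D.
  by move=> e [v /steps[e' De' e'v] ev]; rewrite (joins_edge ev e'v).
apply/seteqP; split=> //.
have par_out u : escapes A n u -> parity vs u = false.
  (* An escape step has both squares outside [A], while an edge of [D] borders [A], so the step does
     not cross the cycle. *)
  elim=> {u} [u nu|u e w uNA wNA eu ew _ IH]; last first.
    rewrite (parity_same Uvs szvs walk _ eu ew) // => /eqP uw /sub.
    case/(frontier_outsideP An)=> z [y [zA _ ez _]].
    by move: eu ew ez => /adjacent_toP[]? /adjacent_toP[]? /adjacent_toP[]?;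
      subst; tauto.
  (* The vertices are corners of squares of [A], hence of height at most [n + 1 <= u.2]. *)
  apply: parity_above => v vvs; have [e /(frontier_outsideP An)] := steps v vvs.
  case=> z [y [/An[_ _ _ zn] _ ez _]] ev; have := joins_corner ez ev.
  by case: v z u {vvs ev ez} zn nu => [v1 v2] [z1 z2] [u1 u2] /= ? ?;
    rewrite !inE !xpair_eqE /=; lia.
have par_in z : A z -> parity vs z = parity vs (0, 0).
  move: z; apply: component_ind => // e z w zA wA ez ew <-.
  apply: (parity_same Uvs szvs walk _ ez ew) => /eqP zw /sub.
  case/(frontier_outsideP An)=> y [u [_ /(escapes_notin An) uNA _ eu]].
  by move: eu ew ez => /adjacent_toP[]? /adjacent_toP[]? /adjacent_toP[]?;
      subst; tauto.
have jump e z u : adjacent_to e z -> adjacent_to e u -> A z -> escapes A n u ->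
    parity vs z = `[< cycle_edges vs e >].
  move=> ez eu zA uesc; have := parity_jump e Uvs szvs walk.
  have zu : z <> u by move=> E; apply: (escapes_notin An uesc); rewrite -E.
  have := par_out u uesc.
  by move: ez eu zu => /adjacent_toP[]-> /adjacent_toP[]-> // _ -> <-;
    rewrite ?addbF ?addFb.
(* The cycle has some edge, and it lies in [D]; the jump across it makes the parity odd on all of
   [A], so the parity jumps across every edge of [D]. *)
have [v vvs] : exists v, v \in vs.
  by exists (nth (0, 0) vs 0); apply: mem_nth; apply: ltn_trans szvs.
have [e De ev] := steps v vvs; have Ze : cycle_edges vs e by exists v.
have /(frontier_outsideP An)[z [u [zA uesc ez eu]]] := De.
move=> e' /(frontier_outsideP An)[z' [u' [z'A u'esc ez' eu']]].
apply/asboolP; rewrite -(jump e' z' u' ez' eu' z'A u'esc) (par_in _ z'A) -(par_in _ zA).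
by rewrite (jump e z u ez eu zA uesc); apply/asboolP.
Qed.

Lemma frontier_outside_cycle :
  finite_set A -> is_cycle occ D.
Proof.
move=> /finite_seqP[s As].
pose r : rel corner := fun u v => `[< exists2 e, D e & joins e u v >].
(* Each endvertex of an edge of [D] is a corner of one of the finitely many squares of [A], which
   gives the finite vertex list for [exists_simple_cycle]. *)
pose corners (z : square) : seq corner :=
  [:: z; (z.1 + 1, z.2); (z.1, z.2 + 1); (z.1 + 1, z.2 + 1)].
have [e De] := frontier_outside_neq0 An (component_origin occ0).
have [|||u v /asboolP[e' De' e'uv]||vs [szvs Uvs cyc]] :=
    @exists_simple_cycle _ r (flatten (map corners s)) (edge_src e) (edge_tgt e).
- by move=> u v; apply/asboolP/asboolP => -[e' ? /joins_sym]; exists e'.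
- by move=> u; apply/asboolP => -[e' _ /joins_neq]; rewrite eqxx.
- move=> u v /asboolP[e' /(frontier_outsideP An)[z [_ [zA _ e'z _]]] e'uv].
  apply/flattenP; exists (corners z); last exact: joins_corner e'z e'uv.
  by apply: map_f; have : [set` s] z by rewrite -As.
- have [e2 De2 [w e2w wv]] := frontier_degree De' e'uv.
  by exists w => //; apply/asboolP; exists e2.
- by apply/asboolP; exists e => //; left.
have steps : {in vs, forall v, exists2 e, D e & joins e v (next vs v)}.
  by move=> v vvs; apply/asboolP; apply: next_cycle cyc vvs.
exists vs; split=> //; last by rewrite -(cycle_edges_frontier Uvs szvs steps).
by move=> v /steps[e' /frontier_graph_edges]; exists e'.
Qed.

(** A vertex of [C] has only two neighbours along [C], and by [frontier_degree] the edges of [D]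
    never stop at a vertex; so one edge of [D] in [C] forces the next one, all the way around. *)
Lemma cycle_eq_frontier (C : set edge) : is_cycle occ C -> D `<=` C -> C = D.
Proof.
move=> [vs [szvs Uvs steps ->]] sub; apply/seteqP; split=> //.
pose P v := exists2 e, D e & exists w, joins e v w.
have key v : v \in vs -> P v -> exists2 e, D e & joins e v (next vs v).
  move=> vvs [e De [w ew]]; have [e' De' [w' e'w' w'w]] := frontier_degree De ew.
  (* Each of the two edges of [D] at [v] leads to the successor or the predecessor of [v], and their
     far ends differ, so one leads to [next vs v]. *)
  have nbr f x : D f -> joins f v x -> x = next vs v \/ x = prev vs v.
    move=> /sub[y yvs fy] fx; case: (joins_endpoints fx fy) => [] [Ev Ex].
      by left; rewrite Ex Ev.
    by right; rewrite Ex Ev prev_next.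
  case: (nbr _ _ De ew) => [Ew|Ew]; first by exists e; rewrite -?Ew.
  case: (nbr _ _ De' e'w') => [Ew'|Ew']; first by exists e'; rewrite -?Ew'.
  by rewrite Ew Ew' eqxx in w'w.
have [e De] := frontier_outside_neq0 An (component_origin occ0).
have [v vvs ev] := sub e De.
have allP : forall w, w \in vs -> P w.
  apply: (next_closed Uvs vvs); first by exists e => //; exists (next vs v).
  move=> w wvs /(key w wvs)[f Df fw]; exists f => //; exists w.
  exact: joins_sym.
move=> f [w wvs fw]; have [f' Df' f'w] := key w wvs (allP w wvs).
by rewrite (joins_edge fw f'w).
Qed.

End OuterCycle.

(** * Components of the complement of a cycle *)

Section Topology.
Variable R : realType.
Implicit Types (p q : R * R) (C : set edge) (z w : square).

Definition rectangle (a : R * R) (r s : R) : set (R * R) :=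
  [set p | `|p.1 - a.1| < r /\ `|p.2 - a.2| < s].

Lemma segment_component (X : set (R * R)) p q :
  (forall t, 0 <= t <= 1 ->
     X (p.1 + t * (q.1 - p.1), p.2 + t * (q.2 - p.2))) ->
  connected_component X p q.
Proof.
move=> sub.
pose f (t : R) : R * R := (p.1 + t * (q.1 - p.1), p.2 + t * (q.2 - p.2)).
have f0 : f 0 = p by rewrite /f !mul0r !addr0 -surjective_pairing.
have f1 : f 1 = q by rewrite /f !mul1r !(addrC _ (_ - _)) !subrK -surjective_pairing.
have fcont : continuous f.
  have affine (a b : R) : continuous (fun t : R => a + t * b).
    by move=> t; apply: cvgD; [|apply: cvgM => //]; exact: cvg_cst.
  by move=> t; exact: (cvg_pair (affine _ _ t) (affine _ _ t)).
apply: (@connected_component_max _ X (f @` `[0, 1]%classic) p).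
- by exists 0; rewrite //= in_itv /= lexx ler01.
- by move=> _ [t t01 <-]; apply: sub; rewrite /= in_itv in t01.
- apply: connected_continuous_connected; first exact: segment_connected.
  exact: continuous_subspaceT.
- by exists 1; rewrite //= in_itv /= lexx ler01.
Qed.

Lemma convex_comb_dist (a x y r t : R) :
  0 <= t <= 1 -> `|x - a| < r -> `|y - a| < r -> `|x + t * (y - x) - a| < r.
Proof.
have comb (u v : R) : 0 <= t <= 1 -> u < r -> v < r -> u + t * (v - u) < r.
  (* The case [t = 1] is separate, since strictness otherwise comes from [(1 - t) * (r - u) > 0]. *)
  move=> /andP[t0]; rewrite le_eqVlt => /predU1P[-> _ vr|t1 ur vr].
    by rewrite mul1r addrC subrK.
  have := mulr_gt0 (_ : 0 < 1 - t) (_ : 0 < r - u).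
  rewrite !subr_gt0 => /(_ t1 ur).
  have := mulr_ge0 t0 (_ : 0 <= r - v); rewrite subr_ge0 => /(_ (ltW vr)).
  by lra.
move=> t01; rewrite !ltr_norml => /andP[xl xr] /andP[yl yr].
have := comb (x - a) (y - a) t01 xr yr.
have := comb (a - x) (a - y) t01; rewrite !ltrBlDr -!ltrBlDl.
move=> /(_ ltac:(lra) ltac:(lra)).
by move=> ? ?; apply/andP; split; lra.
Qed.

Lemma rectangle_component (X : set (R * R)) (a : R * R) (r s : R) p q :
  rectangle a r s `<=` X -> rectangle a r s p -> rectangle a r s q ->
  connected_component X p q.
Proof.
move=> sub [p1 p2] [q1 q2]; apply: segment_component => t t01.
by apply: sub; split; apply: convex_comb_dist.
Qed.

Lemma ltr_int_add1 (m n : int) : (m%:~R : R) < n%:~R + 1 -> m <= n.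
Proof. by rewrite -[1](mulr1z 1) -intrD ltr_int ltzD1. Qed.

(** On a segment one coordinate is an integer minus one half, while in an open square both are less
    than one half away from an integer. *)
Lemma open_square_curve C z : @open_square R z `<=` ~` @curve R C.
Proof.
case: z => z1 z2 p [/=]; rewrite !ltr_norml => /andP[? ?] /andP[? ?].
case=> -[[x y] b] _; rewrite /segment /corner_pt /edge_src /edge_tgt /=.
case: b => /= -[/andP[+ +] /andP[+ +]]; rewrite ?intrD => ? ? ? ?.
- have : y <= z2 by apply: ltr_int_add1; lra.
  have : z2 + 1 <= y by apply: ltr_int_add1; rewrite intrD; lra.
  by lia.
- have : x <= z1 by apply: ltr_int_add1; lra.
  have : z1 + 1 <= x by apply: ltr_int_add1; rewrite intrD; lra.
  by lia.
Qed.

(** The interior of the union of the two closed squares at [e]: a convex set containing both open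
    squares and meeting no lattice edge but [e]. *)
Definition edge_box (e : edge) : set (R * R) :=
  if e.2 then rectangle (e.1.1%:~R, e.1.2%:~R - 2^-1) 2^-1 1
  else rectangle (e.1.1%:~R - 2^-1, e.1.2%:~R) 1 2^-1.

Lemma edge_box_segment (e e' : edge) p :
  edge_box e p -> @segment R e' p -> e' = e.
Proof.
case: e e' => [[x y] b] [[x' y'] b'].
rewrite /edge_box /segment /corner_pt /edge_src /edge_tgt /=.
case: b; case: b' => /= -[] /=; rewrite !ltr_norml ?intrD ?mulr1z;
  move=> /andP[? ?] /andP[? ?] [/andP[? ?] /andP[? ?]].
- have xx' : x <= x' by apply: ltr_int_add1; lra.
  have x'x : x' <= x by apply: ltr_int_add1; lra.
  have yy' : y <= y' by apply: ltr_int_add1; lra.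
  have y'y : y' <= y by apply: ltr_int_add1; lra.
  by congr (_, _, _); lia.
- have : x' <= x by apply: ltr_int_add1; lra.
  have : x + 1 <= x' by apply: ltr_int_add1; rewrite intrD; lra.
  by lia.
- have : y' <= y by apply: ltr_int_add1; lra.
  have : y + 1 <= y' by apply: ltr_int_add1; rewrite intrD; lra.
  by lia.
- have xx' : x <= x' by apply: ltr_int_add1; lra.
  have x'x : x' <= x by apply: ltr_int_add1; lra.
  have yy' : y <= y' by apply: ltr_int_add1; lra.
  have y'y : y' <= y by apply: ltr_int_add1; lra.
  by congr (_, _, _); lia.
Qed.

Lemma open_square_edge_box (e : edge) z :
  adjacent_to e z -> @open_square R z `<=` edge_box e.
Proof.
case: e => [[x y] b] /adjacent_toP[] ->;
  move=> p []; rewrite /edge_box /other_square; case: b => /=;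
  rewrite ?intrD !ltr_norml;
  by move=> /andP[? ?] /andP[? ?]; split; rewrite ltr_norml /=; lra.
Qed.

Lemma adjacent_component C (e : edge) z w p q :
  ~ C e -> adjacent_to e z -> adjacent_to e w ->
  @open_square R z p -> @open_square R w q ->
  connected_component (~` @curve R C) p q.
Proof.
move=> eNC ez ew /(open_square_edge_box ez) + /(open_square_edge_box ew).
have : edge_box e `<=` ~` @curve R C.
  by move=> x ex [e' Ce' /(edge_box_segment ex) Ee]; rewrite Ee in Ce'.
by rewrite /edge_box; case: ifP => _; apply: rectangle_component.
Qed.

Definition center z : R * R := (z.1%:~R, z.2%:~R).

Lemma same_square_component C z p q :
  @open_square R z p -> @open_square R z q ->
  connected_component (~` @curve R C) p q.
Proof.
move=> zp zq; apply: (@rectangle_component _ (center z) 2^-1 2^-1) zp zq.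
exact: open_square_curve.
Qed.

Lemma open_square_center z : @open_square R z (center z).
Proof. by split; rewrite subrr normr0 invr_gt0. Qed.

Lemma bounded_set_pairP (X : set (R * R)) :
  bounded_set X <-> exists M : R, forall p, X p -> `|p.1| <= M /\ `|p.2| <= M.
Proof.
split=> [[M [_ XM]]|[M XM]].
  exists (M + 1) => p Xp; have /XM/(_ p Xp) /= : M < M + 1 by rewrite ltrDl.
  by rewrite prod_normE ge_max => /andP.
exists M; split; first exact: num_real.
move=> N MN p /XM[p1 p2] /=; rewrite prod_normE ge_max.
by rewrite (le_trans p1 (ltW MN)) (le_trans p2 (ltW MN)).
Qed.

Definition closed_square z : set (R * R) :=
  [set p | `|p.1 - z.1%:~R| <= 2^-1 /\ `|p.2 - z.2%:~R| <= 2^-1].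

(** The closed unit intervals around integers are locally finite: those containing [x] are centred
    between [c] and [f], and points strictly between [c - 1/2] and [f + 1/2] lie in no others. *)
Lemma near_half_ball (x : R) :
  \forall y \near x,
    forall m : int, `|y - m%:~R| <= 2^-1 -> `|x - m%:~R| <= 2^-1.
Proof.
pose f := Num.floor (x + 2^-1); pose c := Num.ceil (x - 2^-1).
have /andP[fx xf] := floor_itv (x + 2^-1); have /andP[cx xc] := ceil_itv (x - 2^-1).
rewrite -/f -/c in fx xf cx xc; rewrite intrD mulr1z in xf; rewrite intrB mulr1z in cx.
have yf : \forall y \near x, y < f%:~R + 1 - 2^-1.
  by apply: lt_nbhsl; lra.
have yc : \forall y \near x, c%:~R - 1 + 2^-1 < y.
  by apply: lt_nbhsr; lra.
near=> y => m; rewrite !ler_norml => /andP[my ym].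
have yf1 : y < f%:~R + 1 - 2^-1 by near: y.
have yc1 : c%:~R - 1 + 2^-1 < y by near: y.
have : m <= f by apply: ltr_int_add1; lra.
have : c <= m by apply: ltr_int_add1; lra.
rewrite -!(ler_int R) => ? ?; apply/andP; split; lra.
Unshelve. all: by end_near.
Qed.

(** The set [S] may be infinite; closedness comes from local finiteness, applied in each
    coordinate. *)
Lemma closed_squares_closed (S : set square) :
  closed (\bigcup_(z in S) closed_square z).
Proof.
rewrite -[X in closed X]setCK; apply: open_closedC; rewrite openE => -[x y] /= xyN.
rewrite /interior /=.
exists ([set u | forall m : int, `|u - m%:~R| <= 2^-1 -> `|x - m%:~R| <= 2^-1],
        [set v | forall m : int, `|v - m%:~R| <= 2^-1 -> `|y - m%:~R| <= 2^-1]).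
  by split; exact: near_half_ball.
move=> [u v] [/= ux vy] [z Sz [/= uz vz]]; apply: xyN.
by exists z => //; split; [exact: ux|exact: vy].
Qed.

Lemma closed_square_cover p : exists z, closed_square z p.
Proof.
exists (Num.floor (p.1 + 2^-1), Num.floor (p.2 + 2^-1)).
have /andP[? ?] := floor_itv (p.1 + 2^-1); have /andP[? ?] := floor_itv (p.2 + 2^-1).
by split; rewrite ler_norml /=; lra.
Qed.

Lemma half_ball_int (x : R) (m n : int) :
  `|x - m%:~R| <= 2^-1 -> `|x - n%:~R| <= 2^-1 ->
  [\/ m = n, m = n + 1 /\ x = m%:~R - 2^-1 | n = m + 1 /\ x = n%:~R - 2^-1].
Proof.
rewrite !ler_norml => /andP[xm mx] /andP[xn nx].
have mn : m <= n + 1 by rewrite -(ler_int R) intrD mulr1z; lra.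
have nm : n <= m + 1 by rewrite -(ler_int R) intrD mulr1z; lra.
have [E|[E|E]] : m = n \/ m = n + 1 \/ n = m + 1 by lia.
- by constructor 1.
- by constructor 2; split=> //; rewrite E intrD mulr1z in xm mx *; lra.
- by constructor 3; split=> //; rewrite E intrD mulr1z in xn nx *; lra.
Qed.

(** Two closed squares of one row or column that contain [p] coincide or share an edge through [p],
    and that edge is not in the frontier. *)
Lemma frontier_locally_const (k : square -> bool) z w p :
  (~` @curve R (frontier k)) p -> closed_square z p -> closed_square w p ->
  k z = k w.
Proof.
move=> pN; have off e : @segment R e p -> k e.1 = k (other_square e).
  by move=> ep; apply: contrapT => /eqP ke; apply: pN; exists e.
have vert (x y1 y2 : int) :
    closed_square (x, y1) p -> closed_square (x, y2) p -> k (x, y1) = k (x, y2).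
  move=> [/= px py1] [_ /= py2].
  have seg (y : int) : p.2 = y%:~R - 2^-1 -> @segment R ((x, y), true) p.
    move=> py; move: px; rewrite ler_norml => /andP[? ?].
    rewrite /segment /corner_pt /edge_src /edge_tgt /= py intrD mulr1z.
    by split; apply/andP; split; lra.
  case: (half_ball_int py1 py2) => [->//|[E /seg/off]|[E /seg/off]];
    by rewrite /other_square /= E addrK.
have horiz (x1 x2 y : int) :
    closed_square (x1, y) p -> closed_square (x2, y) p -> k (x1, y) = k (x2, y).
  move=> [/= px1 py] [/= px2 _].
  have seg (x : int) : p.1 = x%:~R - 2^-1 -> @segment R ((x, y), false) p.
    move=> px; move: py; rewrite ler_norml => /andP[? ?].
    rewrite /segment /corner_pt /edge_src /edge_tgt /= px intrD mulr1z.
    by split; apply/andP; split; lra.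
  case: (half_ball_int px1 px2) => [->//|[E /seg/off]|[E /seg/off]];
    by rewrite /other_square /= E addrK.
case: z w => [z1 z2] [w1 w2] zp wp.
(* Membership in a closed square is coordinatewise, so [p] is also in this mixed square, through
   which diagonal neighbours are compared. *)
have wzp : closed_square (w1, z2) p by case: zp wp => [_ ?] [? _].
by rewrite (horiz _ _ _ zp wzp) (vert _ _ _ wzp wp).
Qed.

(** Within the component, the closed squares with [k] false and those with [k] true form two
    disjoint closed sets that cover it; by connectedness the first, which contains [p], is
    everything, and it is boxed. *)
Lemma frontier_bounded_component (k : square -> bool) (n : int) z p :
  boxed n [set z | ~~ k z] -> ~~ k z -> open_square z p ->
  bounded_set (connected_component (~` @curve R (frontier k)) p).
Proof.
move=> kn kz zp; set X := connected_component _ p.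
have closedE w q : open_square w q -> closed_square w q.
  by case=> /ltW ? /ltW ?.
have XN q : X q -> (~` @curve R (frontier k)) q by exact: connected_component_sub.
have XE : X `&` \bigcup_(w in [set w | ~~ k w]) closed_square w = X.
  apply: (@component_connected _ (~` @curve R (frontier k)) p).
  - exists p; split; last by exists z => //; apply: closedE.
    by apply: connected_component_refl; apply: open_square_curve zp.
  - exists (~` \bigcup_(w in [set w | k w]) closed_square w).
      exact/closed_openC/closed_squares_closed.
    apply/seteqP; split=> q [Xq].
      move=> [w /= kw wq]; split=> // -[y /= ky yq]; move: kw.
      by rewrite (frontier_locally_const (XN _ Xq) wq yq) ky.
    have [w wq] := closed_square_cover q; move=> qN; split=> //; exists w => //=.
    by apply/negP => kw; apply: qN; exists w.
  - exists (\bigcup_(w in [set w | ~~ k w]) closed_square w) => //.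
    exact: closed_squares_closed.
apply/bounded_set_pairP; exists (n%:~R + 2^-1) => q; rewrite -XE => -[_ [w /= /kn[]]].
rewrite -!(ler_int R) intrN => ? ? ? ? [].
by rewrite !ler_norml => /andP[? ?] /andP[? ?]; split; apply/andP; split; lra.
Qed.

(** Every edge of [C] borders the component, so escape steps do not cross [C], and above the box a
    whole upward column avoids it. *)
Lemma escapes_unbounded_component (occ : set square) (n : int) C z p :
  boxed n (origin_component occ) -> C `<=` graph_edges occ ->
  escapes (origin_component occ) n z -> open_square z p ->
  ~ bounded_set (connected_component (~` @curve R C) p).
Proof.
move=> An Cgraph; have eNC e z1 z2 : adjacent_to e z1 -> adjacent_to e z2 ->
    z1 != z2 -> ~ origin_component occ z1 -> ~ origin_component occ z2 -> ~ C e.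
  move=> ez1 ez2 z12 z1N z2N /Cgraph[y yA ey]; move/eqP: z12.
  by move: ez1 ez2 ey => /adjacent_toP[]? /adjacent_toP[]? /adjacent_toP[]?;
    subst; tauto.
move=> zesc; elim: zesc p => {z} [z nz|z e w zN wN ez ew _ IH] p zp; last first.
  have [zw|zw] := eqVneq z w; first by apply: IH; rewrite -zw.
  have eC := eNC e z w ez ew zw zN wN; have wc := open_square_center w.
  rewrite (same_connected_component (adjacent_component eC ez ew zp wc)).
  exact/IH/open_square_center.
move=> /bounded_set_pairP[M XM].
have above (d : nat) :
    connected_component (~` @curve R C) p (center (z.1, z.2 + d%:Z)).
  elim: d => [|d IHd].
    rewrite addr0 -surjective_pairing.
    exact: same_square_component zp (open_square_center z).
  apply: connected_component_trans IHd _.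
  pose e : edge := ((z.1, z.2 + d.+1%:Z), true).
  have ed : adjacent_to e (z.1, z.2 + d%:Z).
    by apply/adjacent_toP; right; rewrite /other_square /=; congr (_, _); lia.
  have ed1 := adjacent_to_src e.
  apply: (adjacent_component (eNC _ _ _ ed ed1 _ _ _) ed ed1);
    try exact: open_square_center.
  - by rewrite xpair_eqE; lia.
  - by move=> /An[/=]; lia.
  - by move=> /An[/=]; lia.
(* This [d] brings the centre to height at least [floor M + 1], beyond the bound [M]. *)
have [_] := XM _ (above `|(Num.floor M + 1 - z.2)%R|%N); rewrite /center /=.
have /andP[_ Mlt] := floor_itv M.
move=> /(le_trans (ler_norm _))/le_lt_trans/(_ Mlt); rewrite ltr_int.
by move: (Num.floor M) (z.2) => f y; lia.
Qed.

End Topology.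

(** * The outermost boundary *)

Lemma cycle_graph_edges (occ : set square) (C : set edge) :
  is_cycle occ C -> C `<=` graph_edges occ.
Proof.
case=> vs [_ _ steps ->] f [v vvs fv].
by have [f' f'g f'v] := steps v vvs; rewrite (joins_edge fv f'v).
Qed.

Section OutermostBoundary.
Variables (R : realType) (occ : set square) (n : int).
Hypotheses (occ0 : occ (0, 0)) (An : boxed n (origin_component occ))
  (Afin : finite_set (origin_component occ)).
Let A := origin_component occ.
Let D := frontier (outside A n).

Lemma interior_exterior_disjoint C z :
  square_in_interior R C z -> ~ square_in_exterior R C z.
Proof.
move=> zin zout; have [_ zb] := zin _ (open_square_center R z).
by have [_ /(_ zb)] := zout _ (open_square_center R z).
Qed.

Lemma escapes_in_exterior C z :
  C `<=` graph_edges occ -> escapes A n z -> square_in_exterior R C z.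
Proof.
move=> Cgraph zesc p zp; split; first exact: open_square_curve zp.
exact: escapes_unbounded_component An Cgraph zesc zp.
Qed.

Lemma adjacent_in_exterior C e z w :
  ~ C e -> adjacent_to e z -> adjacent_to e w ->
  square_in_exterior R C w -> square_in_exterior R C z.
Proof.
move=> eNC ez ew wout p zp; split; first exact: open_square_curve zp.
have wc := open_square_center R w.
rewrite (same_connected_component (adjacent_component eNC ez ew zp wc)).
by have [] := wout _ wc.
Qed.

Lemma frontier_encloses : encloses R occ D.
Proof.
move=> z zA p zp; split; first exact: open_square_curve zp.
apply: (frontier_bounded_component (n := n)) zp.
  move=> w /= /asboolPn wN; apply/and4P; apply: contrapT => /negP wout.
  exact/wN/outside_box_escapes.
by apply/asboolPn => /(escapes_notin An).
Qed.

(** Tested against the cycle [D] itself, an outermost edge off [D] would have its square of [A] both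
    inside and outside. Conversely, an edge of [D] off a cycle [C] has an escaping square beside it,
    and being exterior passes across the edge to the other square. *)
Lemma outermost_boundaryE : outermost_boundary R occ = D.
Proof.
apply/seteqP; split=> e.
  move=> [[z zA ez] /(_ D (frontier_outside_cycle occ0 An Afin))[//|eout]].
  by have := interior_exterior_disjoint (frontier_encloses zA) (eout z ez).
move=> De; split; first exact: (frontier_graph_edges An De).
move=> C Ccyc; have [Ce|eNC] := pselect (C e); [by left|right].
have /(frontier_outsideP An)[z [u [_ uesc _ eu]]] := De.
move=> w ew; apply: (adjacent_in_exterior eNC ew eu).
by apply: escapes_in_exterior uesc; exact: cycle_graph_edges.
Qed.

Lemma frontier_inside_outside : inside_occ_outside_vac R occ D.
Proof.
move=> e De; have /(frontier_outsideP An)[z [u [zA uesc ez eu]]] := De.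
(* An occupied square sharing an edge with the component would belong to it. *)
have uNocc : ~ occ u.
  by move=> occu; apply/(escapes_notin An uesc)/(component_step zA occu ez eu).
split; first by split; [exists u|exists z].
- by exists z; split=> //; apply: frontier_encloses.
- exists u; split=> //; apply: escapes_in_exterior uesc.
  exact: frontier_graph_edges.
Qed.

Lemma enclosing_cycle_unique C :
  is_cycle occ C -> encloses R occ C -> C = D.
Proof.
move=> Ccyc Cenc; apply: (cycle_eq_frontier occ0 An Ccyc) => e De.
have /(frontier_outsideP An)[z [u [zA uesc ez eu]]] := De.
apply: contrapT => eNC; apply: (interior_exterior_disjoint (Cenc z zA)).
apply: (adjacent_in_exterior eNC ez eu); apply: escapes_in_exterior uesc.
exact: cycle_graph_edges.
Qed.

End OutermostBoundary.

Theorem theorem2 (R : realType) (occ : set square)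
    (occ0 : occ (0, 0)) (fin_component : finite_set (origin_component occ)) :
  let D := outermost_boundary R occ in
  [/\ is_cycle occ D,
      encloses R occ D,
      inside_occ_outside_vac R occ D
    & forall C : set edge, is_cycle occ C -> encloses R occ C ->
        inside_occ_outside_vac R occ C -> C = D].
Proof.
have [n An] := finite_boxed fin_component.
rewrite /= (outermost_boundaryE R occ0 An fin_component); split.
- exact: frontier_outside_cycle.
- exact: frontier_encloses.
- exact: frontier_inside_outside.
- by move=> C Ccyc Cenc _; exact: (enclosing_cycle_unique occ0 An Ccyc Cenc).
Qed.
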